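(* Let $L$ be a virtual $n$-string link diagram and let $M(L)=(m_{ij})_{n\times n}$ be its bowling ball matrix (defined in the context), with entries in $\mathbb{Z}[s]/(s^2)$. Then: (1) every entry of $M(L)$ has the form $as+b$ with $a\in\mathbb{Z}$ and $b\in\{0,1\}$; (2) $M(L)$ is invariant under generalized Reidemeister moves, so it is an invariant of the virtual $n$-string link represented by $L$. Moreover, $M$ determines a representation of the monoid of virtual $n$-string links: if $L_1L_2$ denotes the virtual string link obtained by placing $L_1$ on top of $L_2$, then $M(L_1L_2)=M(L_1)M(L_2)$, and the trivial $n$-string link is sent to the identity matrix $I_n$.
   Context: A virtual $n$-string link diagram is a collection of $n$ oriented immersed strings in the strip $\mathbb{R}\times[0,1]$, the $i$-th string running from $(i,1)$ to $(\pi(i),0)$ for some permutation $\pi$ of $\{1,\dots,n\}$, whose double points are transverse crossings, each marked either as a real crossing (with over/under information) or as a virtual crossing. Virtual $n$-string links are equivalence classes of such diagrams under the generalized Reidemeister moves (the classical Reidemeister moves $\Omega_1,\Omega_2,\Omega_3$ on real crossings, their virtual analogues $\Omega_1',\Omega_2',\Omega_3'$ involving only virtual crossings, and the mixed move $\Omega_3^s$ in which a strand with two virtual crossings passes across a real crossing), together with planar isotopy fixing the endpoints; they form a monoid under stacking. Bowling ball matrix. A ball is placed at a top endpoint $(i,1)$ and travels along the diagram following the orientation. At a real crossing it always continues along its own strand (weight $1$). At a virtual crossing, rotate the picture so that both strands are oriented downward; one strand enters from the upper left, the other from the upper right. A ball arriving along the strand entering from the upper left jumps onto the other strand (and continues along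 it in its orientation) with weight $s$, and continues along its own strand with weight $1-s$; a ball arriving along the strand entering from the upper right jumps with weight $-s$ and continues with weight $1+s$. Here $s$ is a formal variable with $s^2=0$. A path is a route of the ball from a top endpoint to a bottom endpoint obtained by these choices; its weight is the product in $\mathbb{Z}[s]/(s^2)$ of the weights at all virtual crossings it passes. (Any path with at least two jumps has weight $0$, so only finitely many paths have nonzero weight.) The $(i,j)$ entry $m_{ij}$ of $M(L)$ is the sum of the weights of all paths from $(i,1)$ to $(j,0)$. *)

(* Defs.v *)
From HB Require Import structures.
From mathcomp Require Import all_boot all_order all_algebra ring.
From Stdlib Require Import Relation_Operators.
Set Implicit Arguments. Unset Strict Implicit. Unset Printing Implicit Defensive.
Import GRing.Theory.
Section DualRing.
Local Open Scope ring_scope.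
Record dual := DN { dre : int ; deps : int }.
Definition dual_to (x : dual) := (dre x, deps x).
Definition dual_of (p : int * int) := DN p.1 p.2.
Lemma dual_toK : cancel dual_to dual_of. Proof. by case. Qed.
HB.instance Definition _ := Equality.copy dual (can_type dual_toK).
HB.instance Definition _ := Choice.copy dual (can_type dual_toK).
Definition dadd x y := DN (dre x + dre y) (deps x + deps y).
Definition dopp x := DN (- dre x) (- deps x).
Definition dzero := DN 0 0.
Lemma daddA : associative dadd. Proof. by move=> [a b] [c d] [e f]; rewrite /dadd /= !addrA. Qed.
Lemma daddC : commutative dadd. Proof. by move=> [a b] [c d]; rewrite /dadd /= (addrC a) (addrC b). Qed.
Lemma dadd0 : left_id dzero dadd. Proof. by move=> [a b]; rewrite /dadd /= !add0r. Qed.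
Lemma daddN : left_inverse dzero dopp dadd. Proof. by move=> [a b]; rewrite /dadd /= !addNr. Qed.
HB.instance Definition _ := GRing.isZmodule.Build dual daddA daddC dadd0 daddN.
Definition dmul x y := DN (dre x * dre y) (dre x * deps y + deps x * dre y).
Definition done_ := DN 1 0.
Lemma dmulA : associative dmul. Proof. move=> [a b] [c d] [e f]; rewrite /dmul /=; congr DN; ring. Qed.
Lemma dmulC : commutative dmul. Proof. by move=> [a b] [c d]; rewrite /dmul /=; congr DN; ring. Qed.
Lemma dmul1 : left_id done_ dmul. Proof. by move=> [a b]; rewrite /dmul /=; congr DN; ring. Qed.
Lemma dmulDl : left_distributive dmul dadd. Proof. by move=> [a b] [c d] [e f]; rewrite /dmul /= /dadd /=; congr DN; ring. Qed.
Lemma done_neq0 : done_ != 0. Proof. by []. Qed.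
HB.instance Definition _ := GRing.Zmodule_isComNzRing.Build dual dmulA dmulC dmul1 dmulDl done_neq0.

Definition eps : dual := DN 0 1.
Lemma eps2 : eps * eps = 0. Proof. by []. Qed.
End DualRing.

(* Virtual string link diagrams, in Morse (layered) form.                   *)
(* A diagram is read from top to bottom as a list of elementary layers.     *)
(* Between two layers the diagram meets a horizontal line in finitely many  *)
(* points, listed from left to right; each point carries the orientation of *)
(* the strand through it: true = oriented downward, false = upward.         *)

(* crossing kinds: real crossing (bool = true iff the strand going from the
   upper-left point to the lower-right point is the over strand), or virtual *)
Inductive ckind := CR of bool | CV.

Inductive layer :=
| X of ckind & nat      (* crossing between points i and i+1 *)
| Cap of nat & bool     (* local maximum creating new points i, i+1 below;
                           the bool is the orientation of the new point i  *)
| Cup of nat.           (* local minimum joining points i, i+1 above *)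

Definition flipk (k : ckind) := if k is CR b then CR (~~ b) else CV.

Definition lay_out (s : seq bool) (L : layer) : seq bool :=
  match L with
  | X _ i => take i s ++ [:: nth true s i.+1; nth true s i] ++ drop i.+2 s
  | Cap i o => take i s ++ [:: o; ~~ o] ++ drop i s
  | Cup i => take i s ++ drop i.+2 s
  end.

Definition lay_wf (s : seq bool) (L : layer) : bool :=
  match L with
  | X _ i => i.+1 < size s
  | Cap i _ => i <= size s
  | Cup i => (i.+1 < size s) && (nth true s i != nth true s i.+1)
  end.

(* state t = orientations of the points between layer t-1 and layer t;
   state 0 is the top boundary (n points, all oriented downward) *)
Definition state (n : nat) (D : seq layer) (t : nat) : seq bool :=
  foldl lay_out (nseq n true) (take t D).

Definition wf_diagram (n : nat) (D : seq layer) : bool :=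
  all (fun t => lay_wf (state n D t) (nth (Cup 0) D t)) (iota 0 (size D))
  && (state n D (size D) == nseq n true).

(* a position of the ball: (t, p) = point p of state t; its direction of
   travel is the orientation of that point *)
Definition config := (nat * nat)%type.
Definition dir n D (c : config) : bool := nth true (state n D c.1) c.2.

(* At a crossing in layer l at points i,i+1: strand A joins the upper-left
   point (l,i) and the lower-right point (l+1,i+1); strand B joins (l,i+1)
   and (l+1,i).  The exit end of each strand, following its orientation: *)
Definition outA n D l i : config :=
  if nth true (state n D l) i then (l.+1, i.+1) else (l, i).
Definition outB n D l i : config :=
  if nth true (state n D l) i.+1 then (l.+1, i) else (l, i.+1).

(* possible continuations (weight, next position) of a ball arriving at the
   crossing of kind k in layer l along strand A (onA) or B (~~ onA).
   The first listed option is always "continue along the own strand".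
   When both strands are rotated to point downward, A enters from the upper
   left iff A and B have the same orientation. *)
Definition cross_step n D (k : ckind) l i (onA : bool) : seq (dual * config) :=
  let own := if onA then outA n D l i else outB n D l i in
  let oth := if onA then outB n D l i else outA n D l i in
  if k is CR _ then [:: (1%R, own)] else
  let leftA := nth true (state n D l) i == nth true (state n D l) i.+1 in
  if onA == leftA then [:: ((1 - eps)%R, own); (eps, oth)]
  else [:: ((1 + eps)%R, own); ((- eps)%R, oth)].

Definition step n D (c : config) : seq (dual * config) :=
  let: (t, p) := c in
  if dir n D c then
    if t < size D then
      match nth (Cup 0) D t with
      | X k i => if p == i then cross_step n D k t i true
                 else if p == i.+1 then cross_step n D k t i false
                 else [:: (1%R, (t.+1, p))]
      | Cap i _ => [:: (1%R, (t.+1, if p < i then p else p.+2))]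
      | Cup i => if p == i then [:: (1%R, (t, i.+1))]
                 else if p == i.+1 then [:: (1%R, (t, i))]
                 else [:: (1%R, (t.+1, if p < i then p else p - 2))]
      end
    else [::]
  else
    if t is l.+1 then
      if l < size D then
        match nth (Cup 0) D l with
        | X k i => if p == i then cross_step n D k l i false
                   else if p == i.+1 then cross_step n D k l i true
                   else [:: (1%R, (l, p))]
        | Cap i _ => if p == i then [:: (1%R, (t, i.+1))]
                     else if p == i.+1 then [:: (1%R, (t, i))]
                     else [:: (1%R, (l, if p < i then p else p - 2))]
        | Cup i => [:: (1%R, (l, if p < i then p else p.+2))]
        end
      else [::]
    else [::].

(* following the strand (no jumps) *)
Definition next n D (c : config) : option config :=
  if step n D c is (_, c') :: _ then Some c' else None.

Definition no_closed (n : nat) (D : seq layer) : Prop :=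
  forall t p, t <= size D -> p < size (state n D t) ->
    exists k m, k < n /\ iter m (fun o => obind (next n D) o) (Some (0, k)) = Some (t, p).

Definition is_diagram (n : nat) (D : seq layer) : Prop :=
  wf_diagram n D /\ no_closed n D.

Fixpoint psum n D (fuel : nat) (c : config) (j : nat) : dual :=
  if c.1 == size D then (if c.2 == j then 1%R else 0%R)
  else if fuel is f.+1 then (\sum_(x <- step n D c) x.1 * psum n D f x.2 j)%R
  else 0%R.

(* total number of points of all states; a path with at most one jump (the
   only paths of nonzero weight, as s^2 = 0) visits at most 2 * nconf points,
   so fuel 2 * nconf + 2 captures all paths of nonzero weight *)
Definition nconf n D : nat := \sum_(t < (size D).+1) size (state n D t).

Definition bbm (n : nat) (D : seq layer) : 'M[dual]_n :=
  \matrix_(i < n, j < n) psum n D (nconf n D).*2.+2 (0%N, val i) (val j).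

(* Generalized Reidemeister moves and planar isotopy, as local relations     *)
(* between words of layers (all orientations allowed, given by the states).  *)
Definition lpos (L : layer) : nat :=
  match L with X _ i => i | Cap i _ => i | Cup i => i end.
Definition setpos (L : layer) (j : nat) : layer :=
  match L with X k _ => X k j | Cap _ o => Cap j o | Cup _ => Cup j end.
Definition inw (L : layer) : nat := match L with Cap _ _ => 0 | _ => 2 end.
Definition outw (L : layer) : nat := match L with Cup _ => 0 | _ => 2 end.

Inductive loc_move : seq layer -> seq layer -> Prop :=
| Mfar (L1 L2 : layer) : (lpos L1 + outw L1 <= lpos L2)%N ->
    loc_move [:: L1; L2] [:: setpos L2 (lpos L2 + inw L1 - outw L1); L1]
| Mzig1 i o : loc_move [:: Cap i o; Cup i.+1] [::]
| Mzig2 i o : loc_move [:: Cap i.+1 o; Cup i] [::]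
| Mslcap k i o : loc_move [:: Cap i o; X k i.+1] [:: Cap i.+1 o; X (flipk k) i]
| Mslcup k i : loc_move [:: X k i.+1; Cup i] [:: X (flipk k) i; Cup i.+1]
| Mr1a k i o : loc_move [:: Cap i.+1 o; X k i; Cup i.+1] [::]
| Mr1b k i o : loc_move [:: Cap i o; X k i.+1; Cup i] [::]
| Mr1c k i o : loc_move [:: Cap i o; X k i] [:: Cap i (~~ o)]
| Mr1d k i : loc_move [:: X k i; Cup i] [:: Cup i]
| Mr2 i b : loc_move [:: X (CR b) i; X (CR (~~ b)) i] [::]
| Mr2v i : loc_move [:: X CV i; X CV i] [::]
(* Omega_3 (x: strand p over q, y: p over r, z: q over r, consistent heights) *)
| Mr3 i x y z : (x && z ==> y) -> (~~ x && ~~ z ==> ~~ y) ->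
    loc_move [:: X (CR x) i; X (CR y) i.+1; X (CR z) i]
             [:: X (CR z) i.+1; X (CR y) i; X (CR x) i.+1]
| Mr3v i : loc_move [:: X CV i; X CV i.+1; X CV i] [:: X CV i.+1; X CV i; X CV i.+1]
| Mmix1 i b : loc_move [:: X CV i; X CV i.+1; X (CR b) i]
                       [:: X (CR b) i.+1; X CV i; X CV i.+1]
| Mmix2 i b : loc_move [:: X (CR b) i; X CV i.+1; X CV i]
                       [:: X CV i.+1; X CV i; X (CR b) i.+1].

Definition gen_move (D D' : seq layer) : Prop :=
  exists D1 D2 W W', loc_move W W' /\ D = D1 ++ W ++ D2 /\ D' = D1 ++ W' ++ D2.

Definition vsl_equiv (n : nat) : seq layer -> seq layer -> Prop :=
  clos_refl_sym_trans (seq layer)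
    (fun D D' => is_diagram n D /\ is_diagram n D' /\ gen_move D D').

(* Main.v *)
Require Import Defs.
From HB Require Import structures.
From mathcomp Require Import all_boot all_order all_algebra.
From Stdlib Require Import Relation_Operators.
From mathcomp Require Import zify.
From Stdlib Require Import FunctionalExtensionality.
Set Implicit Arguments. Unset Strict Implicit. Unset Printing Implicit Defensive.
Import GRing.Theory.

(** Assign to each point of the diagram the expected final value of a ball
    leaving it, for given values at the bottom endpoints.  Such assignments are
    exactly the solutions of local linear equations, one system per layer.
    Modulo [s] the ball follows its strand, which reaches the bottom because
    the [n] bottom endpoints lie on pairwise distinct strands from the top; as
    [s^2 = 0], the solution is therefore determined by its bottom values, and
    the top values are [M(D)] applied to the bottom values.  Invariance then
    means that a move preserves the relation that the layers involved impose
    between values above and below, and stacking composes relations.  In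
    solved form a virtual crossing of strands [A] and [B] exchanges the values
    and corrects each of them by a multiple of [s] times their difference; as
    [s^2 = 0] these corrections add up, so any triangle move preserves them. *)

(** * Relations imposed by layers and their invariance under moves *)

Lemma dual_eqP (x y : dual) : dre x = dre y -> deps x = deps y -> x = y.
Proof. by case: x y => [a b] [c d] /= -> ->. Qed.

Definition sgo (o : bool) (z : int) : int := if o then z else (- z)%R.

(* The equations of a virtual crossing solved for the values at the two upper
   points; this form is the same for all four orientations up to the signs. *)
Definition xleft (k : ckind) (o1 : bool) (b0 b1 : dual) : dual :=
  if k is CV then DN (dre b1) (deps b1 + sgo o1 (dre b0 - dre b1))%R else b1.
Definition xright (k : ckind) (o0 : bool) (b0 b1 : dual) : dual :=
  if k is CV then DN (dre b0) (deps b0 + sgo o0 (dre b0 - dre b1))%R else b0.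

Definition core (L : layer) (o0 o1 : bool) (a0 a1 b0 b1 : dual) : Prop :=
  match L with
  | X k _ => a0 = xleft k o1 b0 b1 /\ a1 = xright k o0 b0 b1
  | Cap _ _ => b0 = b1
  | Cup _ => a0 = a1
  end.

(* [a] and [b] are the values at the points above and below the layer, [O] the
   orientations above it.  All three are total functions on [nat]; points
   beyond the end of a state are matched like those to the right of the layer. *)
Definition lrel (O : nat -> bool) (L : layer) (a b : nat -> dual) : Prop :=
  let i := lpos L in
  [/\ core L (O i) (O i.+1) (a i) (a i.+1) (b i) (b i.+1),
      forall p, p < i -> a p = b p
    & forall p, a (inw L + i + p) = b (outw L + i + p)].

Definition lout (O : nat -> bool) (L : layer) (p : nat) : bool :=
  match L with
  | X _ i => O (if p == i then i.+1 else if p == i.+1 then i else p)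
  | Cap i o => if p < i then O p else if p == i then o
               else if p == i.+1 then ~~ o else O (p - 2)
  | Cup i => O (if p < i then p else p.+2)
  end.

(** With total functions as orientations the size conditions of [lay_wf] have no counterpart; a
    minimum must still join opposite orientations. *)
Definition lwf (O : nat -> bool) (L : layer) : bool :=
  if L is Cup i then O i != O i.+1 else true.

Definition oout : (nat -> bool) -> seq layer -> nat -> bool := foldl lout.

Fixpoint owf (O : nat -> bool) (W : seq layer) : bool :=
  if W is L :: W' then lwf O L && owf (lout O L) W' else true.

Fixpoint wrel (O : nat -> bool) (W : seq layer) (a b : nat -> dual) : Prop :=
  if W is L :: W' then exists2 m, lrel O L a m & wrel (lout O L) W' m b
  else a = b.

Lemma owf_cat O W1 W2 : owf O (W1 ++ W2) = owf O W1 && owf (oout O W1) W2.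
Proof. by elim: W1 O => //= L W1 IH O; rewrite IH andbA. Qed.

Lemma wrel_cat O W1 W2 a b :
  wrel O (W1 ++ W2) a b <->
  exists2 m, wrel O W1 a m & wrel (oout O W1) W2 m b.
Proof.
elim: W1 O a => [|L W1 IH] O a /=.
  by split=> [|[m -> //]]; exists a.
split=> [[m Hm /IH[m' H1 H2]]|[m' [m Hm H1] H2]].
  by exists m' => //; exists m.
by exists m => //; apply/IH; exists m'.
Qed.

Lemma lpos_setpos L j : lpos (setpos L j) = j. Proof. by case: L. Qed.
Lemma inw_setpos L j : inw (setpos L j) = inw L. Proof. by case: L. Qed.
Lemma outw_setpos L j : outw (setpos L j) = outw L. Proof. by case: L. Qed.
Lemma core_setpos L j : core (setpos L j) = core L. Proof. by case: L. Qed.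

(** * Translation of layers to the right *)

Definition shift_layer (i : nat) (L : layer) := setpos L (lpos L + i).

Definition glue T (i : nat) (f g : nat -> T) (p : nat) : T :=
  if p < i then f p else g (p - i).

Lemma glueK T i (f g : nat -> T) : (fun p => glue i f g (p + i)) = g.
Proof.
by apply: functional_extensionality => p; rewrite /glue ltnNge leq_addl addnK.
Qed.

Lemma glue_shift T i (f : nat -> T) : glue i f (fun p => f (p + i)) = f.
Proof.
apply: functional_extensionality => p; rewrite /glue.
by case: ltnP => // le_ip; rewrite subnK.
Qed.

Lemma lrel_shift O i L a b :
  lrel O (shift_layer i L) a b <->
  (forall p, p < i -> a p = b p) /\
  lrel (fun p => O (p + i)) L (fun p => a (p + i)) (fun p => b (p + i)).
Proof.
rewrite /lrel /shift_layer.
rewrite lpos_setpos inw_setpos outw_setpos core_setpos !addSn.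
split=> [[H1 H2 H3]|[H0 [H1 H2 H3]]]; split.
- by move=> p lt_pi; apply: H2; lia.
- split=> //; first by move=> p lt_pi; apply: H2; lia.
  by move=> p; rewrite -!addnA (addnC p) !addnA -!(addnA _ _ i) H3.
- by [].
- move=> p lt_pi; case: (ltnP p i) => [/H0 //|le_ip].
  by rewrite -(subnK le_ip); apply: H2; lia.
- by move=> p; rewrite !(addnA _ _ i) !(addnAC _ i) H3.
Qed.

Ltac split_ifs :=
  repeat match goal with
  | |- context [if ?c then _ else _] =>
    lazymatch c with
    | context [if _ then _ else _] => fail
    | _ => case: (boolP c) => ?; try lia
    end
  end.

Lemma lout_shift O i L :
  lout O (shift_layer i L) = glue i O (lout (fun p => O (p + i)) L).
Proof.
apply: functional_extensionality => p; rewrite /glue.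
case: L => [k j|j o|j] /=; case: (ltnP p i) => Hpi;
  split_ifs; try lia; congr O; lia.
Qed.

Lemma owf_shift O i W :
  owf O (map (shift_layer i) W) = owf (fun p => O (p + i)) W.
Proof.
elim: W O => //= L W IH O; rewrite {}IH lout_shift glueK; congr andb.
by case: L.
Qed.

Lemma oout_shift O i W :
  oout O (map (shift_layer i) W) = glue i O (oout (fun p => O (p + i)) W).
Proof.
rewrite /oout; elim: W O => [|L W IH] O /=; first by rewrite glue_shift.
rewrite {}IH lout_shift glueK; apply: functional_extensionality => p.
by rewrite /glue; case: ltnP.
Qed.

Lemma wrel_shift O i W a b :
  wrel O (map (shift_layer i) W) a b <->
  (forall p, p < i -> a p = b p) /\
  wrel (fun p => O (p + i)) W (fun p => a (p + i)) (fun p => b (p + i)).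
Proof.
elim: W O a => [|L W IH] O a /=.
  split=> [-> //|[H1 H2]]; rewrite -(glue_shift i a) -(glue_shift i b) H2.
  by apply: functional_extensionality => p; rewrite /glue; case: ltnP => [/H1|].
rewrite lout_shift; split=> [[m /lrel_shift[H1 H2] /IH[H3]]|[H1 [m H2 H3]]].
  rewrite glueK => H4; split; last by exists (fun p => m (p + i)).
  by move=> p lt_pi; rewrite H1 ?H3.
exists (glue i a m).
  by apply/lrel_shift; rewrite glueK; split=> // p; rewrite /glue => ->.
apply/IH; rewrite !glueK; split=> // p lt_pi.
by rewrite /glue lt_pi H1.
Qed.

(** One implication suffices: a solution carried across the move determines entries of both matrices
    at once. Equal outgoing orientations leave the layers below the move unaffected. *)
Definition move_sound (W W' : seq layer) : Prop :=
  forall O, owf O W ->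
    oout O W' = oout O W /\ forall a b, wrel O W a b -> wrel O W' a b.

Lemma move_sound_shift i W W' :
  move_sound W W' -> move_sound (map (shift_layer i) W) (map (shift_layer i) W').
Proof.
move=> H O; rewrite owf_shift => /H[H1 H2]; rewrite !oout_shift H1.
by split=> // a b /wrel_shift[H3 H4]; apply/wrel_shift; split=> //; apply: H2.
Qed.

Lemma move_sound_far L1 L2 : lpos L1 + outw L1 <= lpos L2 ->
  move_sound [:: L1; L2] [:: setpos L2 (lpos L2 + inw L1 - outw L1); L1].
Proof.
move=> Hfar O _; split.
  rewrite /oout /=; apply: functional_extensionality => p.
  by case: L1 Hfar => [k1 i1|i1 o1|i1]; case: L2 => [k2 i2|i2 o2|i2] /= Hfar;
  split_ifs; try lia; congr O; lia.
move=> a b [m [C1 A1 B1] [m2 [C2 A2 B2] Em]]; subst m2.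
set j := lpos L2 + _ - _; set L2' := setpos _ _.
have p2 : lpos L2' = j := lpos_setpos _ _.
have i2 : inw L2' = inw L2 := inw_setpos _ _.
have w2 : outw L2' = outw L2 := outw_setpos _ _.
have c2 : core L2' = core L2 := core_setpos _ _.
(* Values between the exchanged layers: as in [a] up to the right end of the inputs of [L1]; further
   right [L2] has already acted, so they are those of [b] with the index shift of [L1] undone. *)
pose m' := glue (lpos L1 + inw L1) a (fun q => b (lpos L1 + outw L1 + q)).
have ml p : p < lpos L1 + inw L1 -> m' p = a p by rewrite /m' /glue => ->.
have mr p : lpos L1 + inw L1 <= p -> m' p = b (p + outw L1 - inw L1).
  by move=> le_p; rewrite /m' /glue ltnNge le_p /=; congr b; lia.
have a2 p : lpos L1 + inw L1 <= p -> a p = m (p + outw L1 - inw L1).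
  move=> le_p; rewrite -(subnKC le_p) (addnC (lpos L1)) B1; congr m; lia.
have j1 : lpos L1 + inw L1 <= j by rewrite /j; lia.
have j2 : j + outw L1 - inw L1 = lpos L2 by rewrite /j; lia.
have j3 : j.+1 + outw L1 - inw L1 = (lpos L2).+1 by rewrite /j; lia.
exists m'; [split|exists b => //; split].
- rewrite c2 p2 !mr ?a2 ?j2 ?j3; try lia.
  (* [L2] meets the same orientations in either order. *)
  suff [<- <-] : lout O L1 (lpos L2) = O j /\ lout O L1 (lpos L2).+1 = O j.+1 by [].
  by rewrite /j; case: (L1) Hfar => [k i|i o|i] /= Hfar;
     split; split_ifs; try lia; congr O; lia.
- move=> p; rewrite p2 => lt_p; case: (ltnP p (lpos L1 + inw L1)) => [/ml //|le_p].
  by rewrite mr // a2 // A2 //; lia.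
- move=> p; rewrite i2 w2 p2 a2 ?mr; try lia.
  have -> : inw L2 + j + p + outw L1 - inw L1 = inw L2 + lpos L2 + p by lia.
  have -> : outw L2 + j + p + outw L1 - inw L1 = outw L2 + lpos L2 + p by lia.
  exact: B2.
- have O2 p : p < lpos L1 + inw L1 -> lout O L2' p = O p.
    move=> lt_p; rewrite /L2'; case: (L2) => [k i|i o|i] /=;
    by split_ifs; try lia; congr O; lia.
  clearbody m'; move: (lout O L2') C1 Hfar O2 ml A2; clear.
  case: L1 => [k i|i o|i] /= f C1 Hfar O2 ml A2.
  + by rewrite !O2 ?ml -?A2 //; lia.
  + by rewrite -!A2 //; lia.
  + by rewrite !ml //; lia.
- by move=> p lt_p; rewrite ml ?A1 ?A2 //; lia.
- by move=> p; rewrite mr; [congr b|]; lia.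
Qed.

(** * Soundness of the individual moves, placed at the left margin *)

Section LayersAtTheLeft.
Variables (O : nat -> bool) (a b : nat -> dual).

Lemma lrel_X0 k : lrel O (X k 0) a b <->
  [/\ a 0 = xleft k (O 1) (b 0) (b 1), a 1 = xright k (O 0) (b 0) (b 1)
    & forall p, a p.+2 = b p.+2].
Proof. by split=> [[[H1 H2] _ H3]|[H1 H2 H3]]. Qed.

Lemma lrel_X1 k : lrel O (X k 1) a b <->
  [/\ a 0 = b 0, a 1 = xleft k (O 2) (b 1) (b 2),
      a 2 = xright k (O 1) (b 1) (b 2) & forall p, a p.+3 = b p.+3].
Proof.
split=> [[[H1 H2] H0 H3]|[H0 H1 H2 H3]]; first by split=> //; apply: H0.
by split=> // -[].
Qed.

Lemma lrel_Cap0 o : lrel O (Cap 0 o) a b <->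
  b 0 = b 1 /\ forall p, a p = b p.+2.
Proof. by split=> [[H1 _ H3]|[H1 H3]]. Qed.

Lemma lrel_Cap1 o : lrel O (Cap 1 o) a b <->
  [/\ a 0 = b 0, b 1 = b 2 & forall p, a p.+1 = b p.+3].
Proof.
split=> [[H1 H0 H3]|[H0 H1 H3]]; first by split=> //; apply: H0.
by split=> // -[].
Qed.

Lemma lrel_Cup0 : lrel O (Cup 0) a b <->
  a 0 = a 1 /\ forall p, a p.+2 = b p.
Proof. by split=> [[H1 _ H3]|[H1 H3]]. Qed.

Lemma lrel_Cup1 : lrel O (Cup 1) a b <->
  [/\ a 0 = b 0, a 1 = a 2 & forall p, a p.+3 = b p.+1].
Proof.
split=> [[H1 H0 H3]|[H0 H1 H3]]; first by split=> //; apply: H0.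
by split=> // -[].
Qed.

End LayersAtTheLeft.

Lemma wrel1 O L a b : wrel O [:: L] a b <-> lrel O L a b.
Proof. by split=> [[_ H <-]|H] //; exists b. Qed.

Ltac oout_left :=
  apply: functional_extensionality => -[|[|[|[|?]]]] //=; rewrite ?subn2 //=.

Ltac dual_lia :=
  repeat match goal with
  | H : @eq dual _ _ |- _ =>
      move: (f_equal dre H) (f_equal deps H) => /= ? ?; clear H
  end; apply: dual_eqP => /=; lia.

Lemma move_sound_zig1 o : move_sound [:: Cap 0 o; Cup 1] [::].
Proof.
move=> O /= /andP[HO _]; split.
  by oout_left; case: o (O 0) HO => -[].
move=> a b [m /lrel_Cap0[H1 H2] /wrel1/lrel_Cup1[H3 H4 H5]].
by apply: functional_extensionality => -[|p]; rewrite H2 -?H3 -?H4 ?H1 ?H5.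
Qed.

Lemma move_sound_zig2 o : move_sound [:: Cap 1 o; Cup 0] [::].
Proof.
move=> O /= /andP[HO _]; split.
  by oout_left; case: o (O 0) HO => -[].
move=> a b [m /lrel_Cap1[H1 H2 H3] /wrel1/lrel_Cup0[H4 H5]].
by apply: functional_extensionality => -[|p]; rewrite ?H1 ?H4 ?H2 ?H3 H5.
Qed.

(** The crossing moves to the other leg of the maximum, reversing the left-right order of the two
    strands. For the passing strand the opposite orientation of the new leg compensates this; for
    the bent strand the correction is now read from its other end. *)
Lemma move_sound_slide_cap k o :
  move_sound [:: Cap 0 o; X k 1] [:: Cap 1 o; X (flipk k) 0].
Proof.
move=> O _; split; first by oout_left.
move=> a b [m /lrel_Cap0[H1 H2] /wrel1/lrel_X1[/= H3 H4 H5 H6]].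
(* The feet of [Cap 1 o] are points 1 and 2; the crossing below misses point 2, so their common
   value is [b 2]. *)
exists (fun p => if p is q.+3 then b q.+3 else if p is 0 then a 0 else b 2).
  by apply/lrel_Cap1; split=> // p; rewrite H2 H6.
apply/wrel1/lrel_X0; split=> [||[|p]] //=; rewrite ?H2 ?H5 -H3 H1 H4 ;
  case: k {H4 H5} => [[]|] //=; case: o; case: (O 0); dual_lia.
Qed.

Lemma move_sound_slide_cup k :
  move_sound [:: X k 1; Cup 0] [:: X (flipk k) 0; Cup 1].
Proof.
move=> O /= /andP[HO _]; split.
  by oout_left.
move=> a b [m /lrel_X1[H1 H2 H3 H4] /wrel1/lrel_Cup0[/= H5 H6]].
exists (fun p => if p is q.+3 then b q.+1 else if p is 0 then b 0 else a 2).
  have H7 := H6 0; apply/lrel_X0; split=> [||[|p]] //=; last by rewrite H4 H6.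
    rewrite H1 H5 -H7 H3; case: k {H2 H3} => [[]|] //=.
    by case: (O 0) (O 1) (O 2) HO => [] [] [] // _; dual_lia.
  rewrite H2 H3 -H7; case: k {H2 H3} => [[]|] //=.
  by case: (O 0) (O 1) (O 2) HO => [] [] [] // _; dual_lia.
by apply/wrel1/lrel_Cup1.
Qed.

(** In a kink a strand crosses itself, so both values at the crossing agree modulo [s] and the
    corrections vanish. *)
Lemma move_sound_R1a k o : move_sound [:: Cap 1 o; X k 0; Cup 1] [::].
Proof.
move=> O /= /andP[HO _]; split.
  by oout_left; case: o (O 0) HO => -[].
move=> a b [m /lrel_Cap1[H1 H2 H3] [m' /lrel_X0[/= H4 H5 H6] /wrel1/lrel_Cup1[H7 H8 H9]]].
apply: functional_extensionality => -[|p]; last by rewrite H3 H6 H9.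
have {}HO : O 0 = o by move: HO; clear; case: o (O 0) => -[].
rewrite HO in H5; rewrite H1 -H7; have H := H6 0.
case: k H4 H5 => [x|] /= H4 H5; first congruence.
by case: o {HO} H4 H5 => /= H4 H5; dual_lia.
Qed.

Lemma move_sound_R1b k o : move_sound [:: Cap 0 o; X k 1; Cup 0] [::].
Proof.
move=> O /= /andP[HO _]; split.
  by oout_left; case: o (O 0) HO => -[].
move=> a b [m /lrel_Cap0[H1 H2] [m' /lrel_X1[/= H3 H4 H5 H6] /wrel1/lrel_Cup0[H7 H8]]].
apply: functional_extensionality => -[|p]; last by rewrite H2 H6 H8.
have {}HO : O 0 = ~~ o by move: HO; clear; case: o (O 0) => -[].
rewrite HO in H4; rewrite H2 -H8.
case: k H4 H5 => [x|] /= H4 H5; first congruence.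
by case: o {HO} H4 H5 => /= H4 H5; dual_lia.
Qed.

Lemma move_sound_R1c k o : move_sound [:: Cap 0 o; X k 0] [:: Cap 0 (~~ o)].
Proof.
move=> O _; split; first by oout_left; rewrite negbK.
move=> a b [m /lrel_Cap0[H1 H2] /wrel1/lrel_X0[/= H3 H4 H5]].
apply/wrel1/lrel_Cap0; split=> [|p]; last by rewrite H2.
case: k H3 H4 => [x|] /= H3 H4; first congruence.
by case: o H3 H4 => /= H3 H4; dual_lia.
Qed.

Lemma move_sound_R1d k : move_sound [:: X k 0; Cup 0] [:: Cup 0].
Proof.
move=> O _; split; first by oout_left.
move=> a b [m /lrel_X0[/= H1 H2 H3] /wrel1/lrel_Cup0[H4 H5]].
apply/wrel1/lrel_Cup0; split=> [|p]; last by rewrite H3.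
case: k H1 H2 => [x|] /= H1 H2; first congruence.
by case: (O 0) (O 1) H1 H2 => [] [] /= H1 H2; dual_lia.
Qed.

Lemma move_sound_R2 b : move_sound [:: X (CR b) 0; X (CR (~~ b)) 0] [::].
Proof.
move=> O _; split; first by oout_left.
move=> a c [m /lrel_X0[/= H1 H2 H3] /wrel1/lrel_X0[/= H4 H5 H6]].
by apply: functional_extensionality => -[|[|p]]; congruence.
Qed.

(** The strands have changed places at the second crossing, so the difference there has the opposite
    sign and the corrections cancel. *)
Lemma move_sound_R2v : move_sound [:: X CV 0; X CV 0] [::].
Proof.
move=> O _; split; first by oout_left.
move=> a c [m /lrel_X0[/= H1 H2 H3] /wrel1/lrel_X0[/= H4 H5 H6]].
apply: functional_extensionality => -[|[|p]]; last congruence;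
  by case: (O 0) (O 1) H1 H2 H4 H5 => [] [] /= H1 H2 H4 H5; dual_lia.
Qed.

(** Each pair of strands crosses once on either side, with the same kind, and its corrections depend
    only on orientations and on values modulo [s], which are constant along strands. The real,
    virtual and mixed triangle moves are all instances. *)
Lemma move_sound_R3 k1 k2 k3 :
  move_sound [:: X k1 0; X k2 1; X k3 0] [:: X k3 1; X k2 0; X k1 1].
Proof.
move=> O _; split; first by oout_left.
move=> a b [m /lrel_X0[/= H1 H2 H3] [m' /lrel_X1[/= H4 H5 H6 H7]
  /wrel1/lrel_X0[/= H8 H9 H10]]].
(* The solved form yields the values above a crossing from those below, so the right-hand word is
   filled in from the bottom up. The sign arguments follow the strands, already permuted by the
   crossings higher up. *)
pose n2 p := if p is q.+3 then b q.+3 else nth (b 0)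
  [:: b 0; xleft k1 (O 1) (b 1) (b 2); xright k1 (O 0) (b 1) (b 2)] p.
(* The default [n2 2] of [nth] is the value at point 2, which [X k2 0] leaves alone. *)
pose n1 p := if p is q.+3 then b q.+3 else nth (n2 2)
  [:: xleft k2 (O 2) (n2 0) (n2 1); xright k2 (O 0) (n2 0) (n2 1)] p.
have Hb := H10 0; exists n1; last first.
  exists n2; first by apply/lrel_X0; split=> // -[].
  by apply/wrel1/lrel_X1.
apply/lrel_X1; split=> [||| p]; last by rewrite H3 H7 H10.
  all: rewrite /n1 /n2 /=; move: H1 H2 (H3 0) H4 H5 H6 H8 H9 Hb.
  all: move: (O 0) (O 1) (O 2); clear=> o0 o1 o2.
  all: case: k1 => [?|]; case: k2 => [?|]; case: k3 => [?|] /= *; try congruence.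
  all: destruct o0, o1, o2; dual_lia.
Qed.

Lemma loc_move_is_sound W W' : loc_move W W' -> move_sound W W'.
Proof.
case=> {W W'}.
- exact: move_sound_far.
- move=> i o; exact: (move_sound_shift (i := i) (@move_sound_zig1 o)).
- move=> i o; exact: (move_sound_shift (i := i) (@move_sound_zig2 o)).
- move=> k i o; exact: (move_sound_shift (i := i) (@move_sound_slide_cap k o)).
- move=> k i; exact: (move_sound_shift (i := i) (@move_sound_slide_cup k)).
- move=> k i o; exact: (move_sound_shift (i := i) (@move_sound_R1a k o)).
- move=> k i o; exact: (move_sound_shift (i := i) (@move_sound_R1b k o)).
- move=> k i o; exact: (move_sound_shift (i := i) (@move_sound_R1c k o)).
- move=> k i; exact: (move_sound_shift (i := i) (@move_sound_R1d k)).
- move=> i b; exact: (move_sound_shift (i := i) (@move_sound_R2 b)).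
- move=> i; exact: (move_sound_shift (i := i) move_sound_R2v).
- move=> i x y z _ _; exact: (move_sound_shift (i := i) (@move_sound_R3 _ _ _)).
- move=> i; exact: (move_sound_shift (i := i) (@move_sound_R3 _ _ _)).
- move=> i b; exact: (move_sound_shift (i := i) (@move_sound_R3 _ _ _)).
- move=> i b; exact: (move_sound_shift (i := i) (@move_sound_R3 _ _ _)).
Qed.

Lemma wrel_gen_move O D D' a b :
  gen_move D D' -> owf O D -> wrel O D a b -> wrel O D' a b.
Proof.
case=> D1 [D2 [W [W' [HW [-> ->]]]]].
rewrite !owf_cat => /and3P[_ /(loc_move_is_sound HW)[Eo Hrel] _].
case/wrel_cat=> m H1 /wrel_cat[m' H2 H3]; apply/wrel_cat; exists m => //.
by apply/wrel_cat; exists m'; [exact: Hrel | rewrite Eo].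
Qed.

(** * Trajectories of the ball *)

Lemma dreM (x y : dual) : dre (x * y)%R = (dre x * dre y)%R. Proof. by []. Qed.
Lemma dreD (x y : dual) : dre (x + y)%R = (dre x + dre y)%R. Proof. by []. Qed.

Lemma mul_nilpotent (w x y : dual) :
  dre w = 0%R -> dre x = dre y -> (w * x = w * y)%R.
Proof.
case: w x y => [w0 w1] [x0 x1] [y0 y1] /= -> ->.
by apply: dual_eqP; rewrite /= ?mul0r.
Qed.

Lemma size_lay_out s L :
  lay_wf s L -> size (lay_out s L) = size s + outw L - inw L.
Proof.
case: L => [k i|i o|i] /=; rewrite !size_cat size_take /= ?size_drop;
  move=> H; split_ifs; lia.
Qed.

Lemma nth_lay_out s L :
  lay_wf s L -> nth true (lay_out s L) =1 lout (nth true s) L.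
Proof.
move=> H p; have take_i i u : i <= size s ->
    nth true (take i s ++ u) p = if p < i then nth true s p else nth true u (p - i).
  move=> le_i; rewrite nth_cat size_takel //.
  by case: ifP => // lt_pi; rewrite nth_take.
case: L H => [k i|i o|i] /= H; rewrite take_i; try lia; case: (ltnP p i) => Hp.
- by split_ifs.
- case E: (p - i) => [|[|q]] /=; rewrite ?nth_drop; split_ifs; congr nth; lia.
- by [].
- case E: (p - i) => [|[|q]] /=; rewrite ?nth_drop; split_ifs=> //; congr nth; lia.
- by [].
- by rewrite nth_drop; congr nth; lia.
Qed.

Section Ball.
Variables (n : nat) (D : seq layer).
Hypothesis wfD : wf_diagram n D.

Definition valid (c : config) : bool :=
  (c.1 <= size D) && (c.2 < size (state n D c.1)).

Lemma stateS t : t < size D ->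
  state n D t.+1 = lay_out (state n D t) (nth (Cup 0) D t).
Proof. by move=> lt_t; rewrite /state (take_nth (Cup 0)) // foldl_rcons. Qed.

Lemma state_wf t : t < size D -> lay_wf (state n D t) (nth (Cup 0) D t).
Proof.
by move=> lt_t; case/andP: wfD => /allP/(_ t)+ _; apply; rewrite mem_iota.
Qed.

Lemma state0 : state n D 0 = nseq n true.
Proof. by rewrite /state take0. Qed.

Lemma state_end : state n D (size D) = nseq n true.
Proof. by case/andP: wfD => _ /eqP. Qed.

Lemma nth_nseq_true p : nth true (nseq n true) p = true.
Proof. by rewrite nth_nseq if_same. Qed.

Lemma size_stateS t : t < size D ->
  size (state n D t.+1) + inw (nth (Cup 0) D t) =
  size (state n D t) + outw (nth (Cup 0) D t).
Proof.
move=> lt_t; rewrite stateS // size_lay_out ?state_wf //.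
have := state_wf lt_t; case: nth => [k i|i o|i] /=; lia.
Qed.

Lemma valid_step c : valid c -> all (fun x => valid x.2) (step n D c).
Proof.
case: c => t p /andP[/= le_t lt_p]; rewrite /step /dir /=.
case: ifP => _.
  case: ifP => // lt_t; have := size_stateS lt_t; have := state_wf lt_t.
  case: nth => [k i|i o|i] /=; rewrite /cross_step /outA /outB.
  - by case: k => [x|]; move=> *; split_ifs; rewrite /= /valid /=; lia.
  - by move=> *; split_ifs; rewrite /= /valid /=; lia.
  - by move=> *; split_ifs; rewrite /= /valid /=; lia.
case: t le_t lt_p => // l le_t lt_p.
case: ifP => // lt_t; have := size_stateS lt_t; have := state_wf lt_t.
case: nth => [k i|i o|i] /=; rewrite /cross_step /outA /outB.
- by case: k => [x|]; move=> *; split_ifs; rewrite /= /valid /=; lia.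
- by move=> *; split_ifs; rewrite /= /valid /=; lia.
- by move=> *; split_ifs; rewrite /= /valid /=; lia.
Qed.

(* Only the first continuation, along the own strand, is invertible modulo [s]. *)
Definition step_shape (s : seq (dual * config)) : bool :=
  if s is x :: r then (dre x.1 == 1%R) && all (fun y => dre y.1 == 0%R) r
  else true.

Lemma step_shapeP c : step_shape (step n D c).
Proof.
case: c => t p; rewrite /step.
have Hcross k l i b : step_shape (cross_step n D k l i b).
  by rewrite /cross_step; case: k => //; case: ifP.
case: ifP => _; last case: t => // t.
  by case: ifP => // _; case: nth => [k i|i o|i]; do ?case: ifP.
by case: ifP => // _; case: nth => [k i|i o|i]; do ?case: ifP.
Qed.

Lemma dre_sum_step s (g : config -> dual) : step_shape s ->
  dre (\sum_(x <- s) x.1 * g x.2)%R = if s is x :: _ then dre (g x.2) else 0%R.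
Proof.
case: s => [|x r]; first by rewrite big_nil.
move=> /= /andP[/eqP Hx /allP Hr]; rewrite big_cons dreD dreM Hx mul1r.
rewrite big_seq -[RHS]addr0; congr (_ + _)%R.
elim/big_rec: _ => // y z y_r Ez.
by rewrite dreD Ez addr0 dreM (eqP (Hr _ y_r)) mul0r.
Qed.

(** Jumps have weights divisible by [s], so agreement modulo [s] is enough after a jump; exact
    agreement matters only along the own strand. *)
Lemma eq_sum_step s (g h : config -> dual) : step_shape s ->
  (if s is x :: _ then g x.2 = h x.2 else True) ->
  (forall x, x \in s -> dre (g x.2) = dre (h x.2)) ->
  (\sum_(x <- s) x.1 * g x.2 = \sum_(x <- s) x.1 * h x.2)%R.
Proof.
case: s => [|x r] /=; first by rewrite !big_nil.
move=> /andP[_ /allP Hr] Egh Hdre; rewrite !big_cons Egh; congr (_ + _)%R.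
apply: eq_big_seq => y y_r; apply: mul_nilpotent; first exact/eqP/Hr.
by apply: Hdre; rewrite inE y_r orbT.
Qed.

Definition nexts (m : nat) (o : option config) : option config :=
  iter m (fun o => obind (Defs.next n D) o) o.

(** This looks from each point forward to the bottom, whereas [no_closed] looks back to the top; it
    is the form that supports induction along strands and passes to stacked diagrams. *)
Definition terminating : Prop :=
  forall c, valid c -> exists m q, nexts m (Some c) = Some (size D, q).

Lemma nextsS m c : nexts m.+1 (Some c) = nexts m (Defs.next n D c).
Proof. by rewrite /nexts iterSr. Qed.

Lemma nextsD m1 m2 o : nexts (m1 + m2) o = nexts m1 (nexts m2 o).
Proof. exact: iterD. Qed.

Lemma nexts_None m : nexts m None = None.
Proof. by elim: m => // m IH; rewrite /nexts iterSr. Qed.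

Lemma next_bottom q : Defs.next n D (size D, q) = None.
Proof. by rewrite /Defs.next /step /dir /= state_end nth_nseq_true ltnn. Qed.

Lemma nexts_bottom m q : nexts m.+1 (Some (size D, q)) = None.
Proof. by rewrite nextsS next_bottom nexts_None. Qed.

Lemma next_inv c c' : Defs.next n D c = Some c' ->
  exists w r, step n D c = (w, c') :: r.
Proof. by rewrite /Defs.next; case: step => // -[w c''] r [<-]; exists w, r. Qed.

Lemma valid_next c c' : valid c -> Defs.next n D c = Some c' -> valid c'.
Proof.
by move=> /valid_step + /next_inv[w [r E]]; rewrite E => /= /andP[].
Qed.

Lemma valid_nexts m c c' : valid c -> nexts m (Some c) = Some c' -> valid c'.
Proof.
elim: m c => [c Hc [<-]//|m IH c Hc]; rewrite nextsS.
case E: (Defs.next n D c) => [d|]; last by rewrite nexts_None.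
by apply: IH; apply: valid_next E.
Qed.

Definition all_configs : seq config :=
  [seq (t, p) | t <- iota 0 (size D).+1, p <- iota 0 (size (state n D t))].

Lemma size_all_configs : size all_configs = nconf n D.
Proof.
rewrite size_allpairs_dep sumnE big_map /nconf -(big_mkord xpredT
  (fun t => size (state n D t))).
by rewrite /index_iota subn0; apply: eq_bigr => t _; rewrite size_iota.
Qed.

(** A strand that ends at the bottom visits no point twice. *)
Lemma nexts_bound m c q : valid c ->
  nexts m (Some c) = Some (size D, q) -> m < nconf n D.
Proof.
move=> Hc Hm; rewrite -size_all_configs.
have Hsome k : k <= m -> exists2 d, nexts k (Some c) = Some d & valid d.
  move=> le_k; case E: (nexts k (Some c)) => [d|].
    by exists d => //; apply: valid_nexts E.
  by move: Hm; rewrite -(subnK le_k) nextsD E nexts_None.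
pose tr := [seq odflt c (nexts k (Some c)) | k <- iota 0 m.+1].
rewrite -[m.+1](size_iota 0) -(size_map (fun k => odflt c (nexts k (Some c)))).
apply: uniq_leq_size.
  (* A repetition would bring the ball to the bottom already after [m - k + j] steps, and no step
     leads on from there. *)
  have noteq j k : j < k -> k <= m ->
      odflt c (nexts j (Some c)) <> odflt c (nexts k (Some c)).
    move=> lt_jk le_km.
    have [|d Ej _] := Hsome j; first by lia.
    have [//|e Ek _] := Hsome k; rewrite Ej Ek /= => Ede.
    have : nexts (m - k) (nexts k (Some c)) = Some (size D, q).
      by rewrite -nextsD subnK.
    rewrite Ek -Ede -Ej -nextsD => H.
    have : nexts ((k - j).-1.+1 + (m - k + j)) (Some c) = Some (size D, q).
      by rewrite -Hm; congr nexts; lia.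
    by rewrite nextsD H nexts_bottom.
  rewrite map_inj_in_uniq ?iota_uniq // => j k; rewrite !mem_iota => Hj Hk E.
  by case: (ltngtP j k) => // lt; case: (noteq _ _ lt) => //; lia.
move=> d /mapP[k]; rewrite mem_iota => Hk ->.
have [|e -> /andP[He1 He2]] := Hsome k; first by lia.
case: e He1 He2 => t p /= He1 He2.
by apply/allpairsPdep; exists t, p; rewrite !mem_iota; split=> //; lia.
Qed.

(** * Values determined by the bottom endpoints *)

Definition harmonic (f : config -> dual) : Prop :=
  forall c, valid c -> c.1 != size D ->
  f c = (\sum_(x <- step n D c) x.1 * f x.2)%R.

Lemma harmonic_dre f m c q : harmonic f -> valid c ->
  nexts m (Some c) = Some (size D, q) -> dre (f c) = dre (f (size D, q)).
Proof.
move=> Hf; elim: m c => [c _ [->]//|m IH c Hc]; rewrite nextsS.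
case E: (Defs.next n D c) => [d|]; last by rewrite nexts_None.
move=> Hm; have [Ebot|nbot] := eqVneq c.1 (size D).
  by move: E; rewrite (surjective_pairing c) Ebot next_bottom.
rewrite Hf // dre_sum_step ?step_shapeP //.
have [w [r ->]] := next_inv E; apply: IH => //; exact: valid_next E.
Qed.

Hypothesis termD : terminating.

(** Two rounds along the strand: the first fixes values modulo [s], where jumps do not count; in the
    second the contributions of jumps, being multiples of [s], are already known. *)
Lemma harmonic_uniq f g : harmonic f -> harmonic g ->
  (forall q, valid (size D, q) -> f (size D, q) = g (size D, q)) ->
  forall c, valid c -> f c = g c.
Proof.
move=> Hf Hg Efg.
have Edre c : valid c -> dre (f c) = dre (g c).
  move=> Hc; have [m [q Hm]] := termD Hc.
  rewrite (harmonic_dre Hf Hc Hm) (harmonic_dre Hg Hc Hm) Efg //.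
  exact: valid_nexts Hm.
move=> c Hc; have [m [q Hm]] := termD Hc.
elim: m c Hc Hm => [c Hc [Ec]|m IH c Hc]; first by rewrite Ec in Hc *; apply: Efg.
rewrite nextsS; case E: (Defs.next n D c) => [d|]; last by rewrite nexts_None.
move=> Hm; have [Ebot|nbot] := eqVneq c.1 (size D).
  by move: E; rewrite (surjective_pairing c) Ebot next_bottom.
rewrite Hf // Hg //; apply: eq_sum_step; first exact: step_shapeP.
  have [w [r ->]] := next_inv E; apply: IH => //; exact: valid_next E.
by move=> x x_c; apply: Edre; apply: (allP (valid_step Hc)).
Qed.

Lemma psum_bottom f q j : psum n D f (size D, q) j = if q == j then 1%R else 0%R.
Proof. by case: f => [|f] /=; rewrite eqxx. Qed.

Lemma psumS f c j : c.1 != size D ->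
  psum n D f.+1 c j = (\sum_(x <- step n D c) x.1 * psum n D f x.2 j)%R.
Proof. by rewrite /= => /negbTE ->. Qed.

Lemma psum_dre_fuel m c q j f f' : valid c ->
  nexts m (Some c) = Some (size D, q) -> m <= f -> m <= f' ->
  dre (psum n D f c j) = dre (psum n D f' c j).
Proof.
elim: m c f f' => [c f f' _ [->]|m IH c f f' Hc]; first by rewrite !psum_bottom.
rewrite nextsS; case E: (Defs.next n D c) => [d|]; last by rewrite nexts_None.
move=> Hm; have [Ebot|nbot] := eqVneq c.1 (size D).
  by move: E; rewrite (surjective_pairing c) Ebot next_bottom.
case: f f' => [|f] [|f'] // lt_f lt_f'; rewrite !psumS //.
rewrite !(dre_sum_step (psum n D _ ^~ j)) ?step_shapeP //.
have [w [r ->]] := next_inv E; apply: IH => //; exact: valid_next E.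
Qed.

(** Following the strand takes [m] units of fuel; after a jump only the real part counts, and fewer
    than [nconf n D] further units settle it. *)
Lemma psum_fuel m c q j f f' : valid c ->
  nexts m (Some c) = Some (size D, q) ->
  m + nconf n D <= f -> m + nconf n D <= f' ->
  psum n D f c j = psum n D f' c j.
Proof.
elim: m c f f' => [c f f' _ [->]|m IH c f f' Hc]; first by rewrite !psum_bottom.
rewrite nextsS; case E: (Defs.next n D c) => [d|]; last by rewrite nexts_None.
move=> Hm; have [Ebot|nbot] := eqVneq c.1 (size D).
  by move: E; rewrite (surjective_pairing c) Ebot next_bottom.
case: f f' => [|f] [|f'] // lt_f lt_f'; rewrite !psumS //.
apply: (eq_sum_step (g := psum n D f ^~ j) (h := psum n D f' ^~ j)).
- exact: step_shapeP.
- have [w [r ->]] := next_inv E; apply: IH => //; exact: valid_next E.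
move=> x x_c; have Hx := allP (valid_step Hc) _ x_c.
have [k [q' Hk]] := termD Hx; have lt_k := nexts_bound Hx Hk.
by apply: (psum_dre_fuel j Hx Hk); lia.
Qed.

(** Unfolding one step lowers the fuel to [(nconf n D).*2.+1], which still exceeds a strand length
    plus [nconf n D], so the value does not change. *)
Lemma psum_harmonic j :
  harmonic (fun c => psum n D (nconf n D).*2.+2 c j).
Proof.
move=> c Hc nbot; rewrite psumS //; apply: eq_big_seq => x x_c; congr (_ * _)%R.
have Hx := allP (valid_step Hc) _ x_c.
have [k [q Hk]] := termD Hx; have lt_k := nexts_bound Hx Hk.
by apply: (psum_fuel j Hx Hk); lia.
Qed.

End Ball.

(** * The bowling ball matrix as the solution of the layer relations *)

Lemma left_stepE (x y : dual) : ((1 - eps) * x + eps * y)%R =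
  DN (dre x) (deps x + (dre y - dre x))%R.
Proof.
case: x y => [x0 x1] [y0 y1]; rewrite /= !mulrDl mulNr mul1r.
by apply: dual_eqP => /=; lia.
Qed.

Lemma right_stepE (x y : dual) : ((1 + eps) * x + (- eps) * y)%R =
  DN (dre x) (deps x - (dre y - dre x))%R.
Proof.
case: x y => [x0 x1] [y0 y1]; rewrite /= !mulrDl mulNr mul1r.
by apply: dual_eqP => /=; lia.
Qed.

(** The right-hand sides are the ball's equations at the entry ends of the two strands. All
    orientations give one solved form since [s] times a value depends only on its real part, which
    is the same at both ends of a strand. *)
Lemma cross_stepP n D (f : config -> dual) k l i :
  let o0 := nth true (state n D l) i in
  let o1 := nth true (state n D l) i.+1 in
  core (X k i) o0 o1 (f (l, i)) (f (l, i.+1)) (f (l.+1, i)) (f (l.+1, i.+1)) <->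
  f (if o0 then (l, i) else (l.+1, i.+1)) =
    (\sum_(x <- cross_step n D k l i true) x.1 * f x.2)%R /\
  f (if o1 then (l, i.+1) else (l.+1, i)) =
    (\sum_(x <- cross_step n D k l i false) x.1 * f x.2)%R.
Proof.
rewrite /cross_step /outA /outB /=.
case: k => [x|] /=; case: (nth _ _ i); case: (nth _ _ i.+1) => /=;
  rewrite !(big_cons, big_nil) /= ?mul1r !addr0 ?left_stepE ?right_stepE;
  by split=> -[? ?]; split; try congruence; dual_lia.
Qed.

(* [p] above the layer and [p'] below it lie on the same vertical strand that
   the layer leaves untouched. *)
Definition untouched (L : layer) (p p' : nat) : Prop :=
  (p = p' /\ p < lpos L) \/
  (exists q, p = inw L + lpos L + q /\ p' = outw L + lpos L + q).

Lemma lout_untouched O L p p' : untouched L p p' -> lout O L p' = O p.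
Proof.
rewrite /untouched; case: L => [k i|i o|i] /= [[-> Hp]|[q [-> ->]]];
  by split_ifs; congr O; lia.
Qed.

Section Bridge.
Variables (n : nat) (D : seq layer).
Hypothesis wfD : wf_diagram n D.
Local Notation st t := (state n D t).
Local Notation ly t := (nth (Cup 0) D t).

Lemma nth_stateS t p : t < size D ->
  nth true (st t.+1) p = lout (nth true (st t)) (ly t) p.
Proof. by move=> lt_t; rewrite stateS // nth_lay_out // state_wf. Qed.

Lemma step_untouched_down t p p' : t < size D -> untouched (ly t) p p' ->
  nth true (st t) p -> step n D (t, p) = [:: (1%R, (t.+1, p'))].
Proof.
move=> lt_t Hthr Op; rewrite /step /dir /= Op lt_t.
move: Hthr; rewrite /untouched; case: (ly t) => [k i|i o|i] /= [[-> Hp]|[q [-> ->]]];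
  rewrite ?Hp //; split_ifs; congr [:: (_, (_, _))]; lia.
Qed.

Lemma step_untouched_up t p p' : t < size D -> untouched (ly t) p p' ->
  ~~ nth true (st t.+1) p' -> step n D (t.+1, p') = [:: (1%R, (t, p))].
Proof.
move=> lt_t Hthr Op; rewrite /step /dir /= (negbTE Op) lt_t.
move: Hthr; rewrite /untouched; case: (ly t) => [k i|i o|i] /= [[-> Hp]|[q [-> ->]]];
  rewrite ?Hp //; split_ifs; congr [:: (_, (_, _))]; lia.
Qed.

Lemma size_untouched t p p' : t < size D -> untouched (ly t) p p' ->
  (p < size (st t)) = (p' < size (st t.+1)).
Proof.
move=> lt_t; have := size_stateS wfD lt_t; have := state_wf wfD lt_t.
by rewrite /untouched; case: (ly t) => [k i|i o|i] /= ? ? [[-> Hp]|[q [-> ->]]]; lia.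
Qed.

Lemma lrel_untouched O L a b p p' : lrel O L a b -> untouched L p p' -> a p = b p'.
Proof. by case=> _ H1 H2 [[<- /H1]|[q [-> ->]]]. Qed.

Lemma harmonic_down f t p : harmonic n D f -> t < size D -> p < size (st t) ->
  nth true (st t) p -> f (t, p) = (\sum_(x <- step n D (t, p)) x.1 * f x.2)%R.
Proof. by move=> Hf lt_t Hp _; rewrite -Hf // /valid /= ?(ltnW lt_t) ?ltn_eqF. Qed.

Lemma harmonic_up f t p : harmonic n D f -> t < size D ->
  p < size (st t.+1) -> ~~ nth true (st t.+1) p ->
  f (t.+1, p) = (\sum_(x <- step n D (t.+1, p)) x.1 * f x.2)%R.
Proof.
move=> Hf lt_t Hp Op; rewrite -Hf // /valid /= ?lt_t //.
by apply: contra Op => /eqP ->; rewrite state_end // nth_nseq_true.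
Qed.

Lemma harmonic_untouched f t p p' : harmonic n D f -> t < size D ->
  untouched (ly t) p p' -> p < size (st t) -> f (t, p) = f (t.+1, p').
Proof.
move=> Hf lt_t Hthr Hp; have Hp' := Hp; rewrite (size_untouched lt_t Hthr) in Hp'.
case Op: (nth true (st t) p).
  rewrite (harmonic_down Hf lt_t Hp Op) (step_untouched_down lt_t Hthr) //.
  by rewrite big_seq1 mul1r.
have Op' : ~~ nth true (st t.+1) p' by rewrite nth_stateS // (lout_untouched _ Hthr) Op.
rewrite (harmonic_up Hf lt_t Hp' Op') (step_untouched_up lt_t Hthr) //.
by rewrite big_seq1 mul1r.
Qed.

(** The relation also matches points beyond the ends of the states; the vanishing of [f] there
    supplies these equations. *)
Lemma harmonic_lrel f t : harmonic n D f ->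
  (forall u p, u <= size D -> size (st u) <= p -> f (u, p) = 0%R) ->
  t < size D ->
  lrel (nth true (st t)) (ly t) (fun p => f (t, p)) (fun p => f (t.+1, p)).
Proof.
move=> Hf Zf lt_t.
have Hthr p p' : untouched (ly t) p p' -> f (t, p) = f (t.+1, p').
  move=> H; case: (ltnP p (size (st t))) => Hp; first exact: harmonic_untouched.
  have Hp' : size (st t.+1) <= p' by rewrite leqNgt -(size_untouched lt_t H) -leqNgt.
  by rewrite !Zf // ltnW.
split; last 2 first.
- by move=> p lt_p; apply: Hthr; left.
- by move=> q; apply: Hthr; right; exists q.
have := size_stateS wfD lt_t; have := state_wf wfD lt_t.
have Hd p := harmonic_down (p := p) Hf lt_t.
have Hu p := harmonic_up (p := p) Hf lt_t.
have OS p := nth_stateS p lt_t.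
have Sd p : nth true (st t) p -> step n D (t, p) = match ly t with
      | X k i => if p == i then cross_step n D k t i true
                 else if p == i.+1 then cross_step n D k t i false
                 else [:: (1%R, (t.+1, p))]
      | Cap i _ => [:: (1%R, (t.+1, if p < i then p else p.+2))]
      | Cup i => if p == i then [:: (1%R, (t, i.+1))]
                 else if p == i.+1 then [:: (1%R, (t, i))]
                 else [:: (1%R, (t.+1, if p < i then p else p - 2))]
      end by rewrite /step /dir /= lt_t => ->.
have Su p : ~~ nth true (st t.+1) p -> step n D (t.+1, p) = match ly t with
        | X k i => if p == i then cross_step n D k t i false
                   else if p == i.+1 then cross_step n D k t i true
                   else [:: (1%R, (t, p))]
        | Cap i _ => if p == i then [:: (1%R, (t.+1, i.+1))]
                     else if p == i.+1 then [:: (1%R, (t.+1, i))]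
                     else [:: (1%R, (t, if p < i then p else p - 2))]
        | Cup i => [:: (1%R, (t, if p < i then p else p.+2))]
        end by rewrite /step /dir /= lt_t => /negbTE ->.
case: (ly t) OS Sd Su => [k i|i o|i] OS Sd Su /= Hwf Hsz.
- apply/(cross_stepP n D f k t i); split.
    case: ifPn => Oi; first by rewrite Hd ?Sd ?eqxx //; lia.
    have Oi' : ~~ nth true (st t.+1) i.+1 by rewrite OS /= eqxx gtn_eqF.
    by rewrite Hu ?Su ?eqxx ?gtn_eqF //; lia.
  case: ifPn => Oi; first by rewrite Hd ?Sd ?eqxx ?gtn_eqF //; lia.
  have Oi' : ~~ nth true (st t.+1) i by rewrite OS /= eqxx.
  by rewrite Hu ?Su ?eqxx ?gtn_eqF //; lia.
(* The equation of a maximum comes from its foot directed upwards, where the ball turns to the other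
   foot. *)
- case: o OS => OS.
    have Oi : ~~ nth true (st t.+1) i.+1 by rewrite OS /= ltnNge leqnSn eqxx gtn_eqF.
    by rewrite [RHS]Hu ?Su ?eqxx ?gtn_eqF ?big_seq1 ?mul1r //; lia.
  have Oi : ~~ nth true (st t.+1) i by rewrite OS /= ltnn eqxx.
  by rewrite Hu ?Su ?eqxx ?big_seq1 ?mul1r //; lia.
case/andP: Hwf => Hi; case Oi: (nth true (st t) i) => HO.
  by rewrite Hd ?Sd ?Oi ?eqxx ?big_seq1 ?mul1r //; lia.
have Oi' : nth true (st t) i.+1 by case: nth HO.
by rewrite [RHS]Hd ?Sd ?eqxx ?gtn_eqF ?big_seq1 ?mul1r //; lia.
Qed.

Lemma window_cases i w p : [\/ p < i, exists q, p = w + i + q | i <= p < i + w].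
Proof.
case: (ltnP p i) => H1; first by constructor 1.
case: (ltnP p (i + w)) => H2; first by constructor 3; apply/andP.
by constructor 2; exists (p - (w + i)); lia.
Qed.

Lemma lrel_harmonic f :
  (forall t, t < size D ->
    lrel (nth true (st t)) (ly t) (fun p => f (t, p)) (fun p => f (t.+1, p))) ->
  harmonic n D f.
Proof.
move=> Hl [t p] /andP[le_t Hp] nbot; rewrite /= in le_t Hp nbot.
case Op: (nth true (st t) p).
  have lt_t : t < size D by rewrite ltn_neqAle nbot.
  have Ht := Hl t lt_t.
  case: (window_cases (lpos (ly t)) (inw (ly t)) p) => [lt_p|[q Eq]|Hw].
  - have Hthr : untouched (ly t) p p by left.
    by rewrite (step_untouched_down lt_t Hthr) // big_seq1 mul1r (lrel_untouched Ht Hthr).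
  - have Hthr : untouched (ly t) p (outw (ly t) + lpos (ly t) + q) by right; exists q.
    by rewrite (step_untouched_down lt_t Hthr) // big_seq1 mul1r (lrel_untouched Ht Hthr).
  case: Ht => Hcore _ _; move: Hcore Hw; rewrite /step /dir /= Op lt_t.
  case: (ly t) => [k i|i o|i] /= Hcore Hw; last 1 first.
  - have [->|->] : p = i \/ p = i.+1 by lia.
      by rewrite eqxx big_seq1 mul1r.
    by rewrite eqxx gtn_eqF // big_seq1 mul1r.
  - case/(cross_stepP n D f k t i): Hcore => HA HB.
    have [E|E] : p = i \/ p = i.+1 by lia.
      by rewrite E eqxx -HA -E Op.
    by rewrite E eqxx gtn_eqF // -HB -E Op.
  - by lia.
(* An upward point has a layer above it, since the top state has only downward points. *)
case: t le_t Hp nbot Op => [|t] lt_t Hp nbot Op.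
  by move: Op; rewrite state0 nth_nseq_true.
have Ht := Hl t lt_t; have /negbT Op' := Op.
case: (window_cases (lpos (ly t)) (outw (ly t)) p) => [lt_p|[q Eq]|Hw].
- have Hthr : untouched (ly t) p p by left.
  by rewrite (step_untouched_up lt_t Hthr) // big_seq1 mul1r (lrel_untouched Ht Hthr).
- have Hthr : untouched (ly t) (inw (ly t) + lpos (ly t) + q) p by right; exists q.
  by rewrite (step_untouched_up lt_t Hthr) // big_seq1 mul1r (lrel_untouched Ht Hthr).
case: Ht => Hcore _ _; have OS := nth_stateS p lt_t; move: Hcore Hw OS.
rewrite /step /dir /= Op lt_t.
case: (ly t) => [k i|i o|i] /= Hcore Hw OS.
- case/(cross_stepP n D f k t i): Hcore => HA HB.
  have [E|E] : p = i \/ p = i.+1 by lia.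
    by rewrite E eqxx -HB; move: OS; rewrite E eqxx => <-.
  by rewrite E eqxx gtn_eqF // -HA; move: OS; rewrite E eqxx gtn_eqF // => <-.
- have [->|->] : p = i \/ p = i.+1 by lia.
    by rewrite eqxx big_seq1 mul1r.
  by rewrite eqxx gtn_eqF // big_seq1 mul1r.
- by lia.
Qed.

Lemma oout_state t : t <= size D ->
  oout (nth true (nseq n true)) (take t D) = nth true (st t).
Proof.
elim: t => [|t IH] lt_t; first by rewrite state0 take0.
rewrite (take_nth (Cup 0)) // /oout foldl_rcons [foldl _ _ _](IH (ltnW lt_t)).
by apply: functional_extensionality => p; rewrite nth_stateS.
Qed.

Lemma owf_state : owf (nth true (nseq n true)) D.
Proof.
suff H t : t <= size D -> owf (nth true (nseq n true)) (take t D).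
  by rewrite -(take_size D) H.
elim: t => [|t IH] lt_t; first by rewrite take0.
rewrite (take_nth (Cup 0)) // -cats1 owf_cat (IH (ltnW lt_t)) (oout_state (ltnW lt_t)) /=.
have := state_wf wfD lt_t.
by case: (ly t) => //= i /andP[_ ->].
Qed.

End Bridge.

Lemma wrel_chain O W a b : wrel O W a b <->
  exists v : nat -> nat -> dual, [/\ v 0 = a, v (size W) = b
    & forall t, t < size W ->
      lrel (oout O (take t W)) (nth (Cup 0) W t) (v t) (v t.+1)].
Proof.
elim: W O a => [|L W IH] O a /=.
  split=> [->|[v [<- <- _]] //]; by exists (fun=> b).
split=> [[m Hm /IH[v [v0 vW Hv]]]|[v [v0 vW Hv]]].
  exists (fun t => if t is t'.+1 then v t' else a); split=> // -[_|t lt_t] /=.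
    by rewrite v0.
  exact: Hv.
exists (v 1); first by have := Hv 0 isT; rewrite /= v0.
by apply/IH; exists (fun t => v t.+1); split=> // t lt_t; have := Hv t.+1 lt_t.
Qed.

(** * Existence and uniqueness of solutions *)

Local Notation Otop n := (nth true (nseq n true)).

Section Matrix.
Variables (n : nat) (D : seq layer).
Hypotheses (wfD : wf_diagram n D) (termD : terminating n D).

Let value (b : nat -> dual) (c : config) : dual :=
  (\sum_(k < n) psum n D (nconf n D).*2.+2 c k * b k)%R.

Lemma value_harmonic b : harmonic n D (value b).
Proof.
move=> c Hc nbot; rewrite /value.
under eq_bigr => k _ do rewrite psum_harmonic // mulr_suml.
rewrite exchange_big; apply: eq_bigr => x _ /=.
by rewrite mulr_sumr; apply: eq_bigr => k _; rewrite mulrA.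
Qed.

Lemma value_bottom b q : q < n -> value b (size D, q) = b q.
Proof.
move=> lt_q; rewrite /value (bigD1 (Ordinal lt_q)) // psum_bottom eqxx mul1r.
rewrite -[RHS]addr0; congr (_ + _)%R; apply: big1 => k nk.
rewrite psum_bottom ifN ?mul0r //.
by apply: contra nk => /eqP E; apply/eqP/val_inj.
Qed.

Lemma wrel_bbm a b (i : 'I_n) : wrel (Otop n) D a b ->
  a i = (\sum_(k < n) bbm n D i k * b k)%R.
Proof.
case/wrel_chain=> v [<- Ev Hv].
have Hf : harmonic n D (fun c => v c.1 c.2).
  by apply: lrel_harmonic => // t lt_t; rewrite -(oout_state wfD (ltnW lt_t)); apply: Hv.
have -> : v 0 i = value b (0, val i).
  apply: (harmonic_uniq wfD termD Hf (value_harmonic b) _ (c := (0, val i))).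
    by move=> q /andP[_]; rewrite state_end // size_nseq Ev => /value_bottom ->.
  by rewrite /valid state0 size_nseq ltn_ord.
by apply: eq_bigr => k _; rewrite mxE.
Qed.

(** Harmonic values are cut off to zero outside the states, which fits [b] as it vanishes from [n]
    on. Since [a] vanishes there too, it can serve as bottom values of a diagram stacked on top. *)
Lemma wrel_total b : (forall p, n <= p -> b p = 0%R) ->
  exists a, (forall p, n <= p -> a p = 0%R) /\ wrel (Otop n) D a b.
Proof.
move=> b0; pose f (c : config) := if c.2 < size (state n D c.1) then value b c else 0%R.
exists (fun p => f (0, p)); split=> [p le_p|].
  by rewrite /f state0 size_nseq ltnNge le_p.
apply/wrel_chain; exists (fun t p => f (t, p)); split=> //.
  apply: functional_extensionality => p; rewrite /f /= state_end // size_nseq.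
  by case: ltnP => [/value_bottom|/b0].
move=> t lt_t; rewrite (oout_state wfD (ltnW lt_t)); apply: harmonic_lrel => //.
  move=> c Hc nbot; have Hc2 := Hc; case/andP: Hc2 => _ Hc2.
  rewrite {1}/f Hc2 value_harmonic //; apply: eq_big_seq => x x_c.
  by have /andP[_ Hx] := allP (valid_step wfD Hc) _ x_c; rewrite /f Hx.
by move=> u p _ le_p; rewrite /f /= ltnNge le_p.
Qed.

End Matrix.

Lemma delta_out n (j : 'I_n) p : n <= p -> (if p == j then 1 else 0)%R = 0%R :> dual.
Proof. by move=> le_p; rewrite gtn_eqF //; have := ltn_ord j; lia. Qed.

Lemma sum_delta n (F : 'I_n -> dual) (j : 'I_n) :
  (\sum_(k < n) F k * (if val k == j then 1 else 0) = F j)%R.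
Proof.
rewrite (bigD1 j) //= eqxx mulr1 big1 ?addr0 // => k /negbTE.
by rewrite -val_eqE /= => ->; rewrite mulr0.
Qed.

(** Every bottom endpoint is reached from the top, distinct ones from distinct top endpoints because
    trajectories stop at the bottom. By counting, every top endpoint leads to the bottom, and so
    does every point on its strand. *)
Lemma terminating_diagram n D : is_diagram n D -> terminating n D.
Proof.
case=> wfD closedD.
have past_bottom m m' o q : nexts n D m o = Some (size D, q) -> m < m' ->
    nexts n D m' o = None.
  move=> Hm lt_m; rewrite -(subnK (ltnW lt_m)) nextsD Hm.
  by rewrite -(prednK (n := m' - m)) ?subn_gt0 // nexts_bottom.
have top_bottom : exists K : 'I_n -> 'I_n, forall p : 'I_n,
    exists m, nexts n D m (Some (0, val (K p))) = Some (size D, val p).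
  apply: (@fin_all_exists 'I_n (fun=> 'I_n) (fun p k => exists m,
    nexts n D m (Some (0, val k)) = Some (size D, val p))) => p.
  have [//||k [m [lt_k Hm]]] := closedD (size D) p.
    by rewrite state_end // size_nseq.
  by exists (Ordinal lt_k), m.
case: top_bottom => K HK.
have K_inj : injective K.
  move=> p q Epq; have [m Hm] := HK p; have [m' Hm'] := HK q; rewrite Epq in Hm.
  case: (ltngtP m m') => Hmm; last by move: Hm Hm'; rewrite Hmm => -> [/val_inj].
    by rewrite (past_bottom _ _ _ _ Hm Hmm) in Hm'.
  by rewrite (past_bottom _ _ _ _ Hm' Hmm) in Hm.
move=> [t p] /andP[/= le_t lt_p]; have [k [m [lt_k Hm]]] := closedD t p le_t lt_p.
have [K' _ K'K] := injF_bij K_inj; have [M HM] := HK (K' (Ordinal lt_k)).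
rewrite K'K /= in HM; rewrite -/(nexts n D m _) in Hm.
case: (leqP m M) => HmM.
  exists (M - m), (val (K' (Ordinal lt_k))).
  by rewrite -Hm -nextsD subnK.
by rewrite (past_bottom _ _ _ _ HM HmM) in Hm.
Qed.

(** * Stacking of diagrams *)

Section Stacking.
Variables (n : nat) (D1 D2 : seq layer).
Hypotheses (wf1 : wf_diagram n D1) (wf2 : wf_diagram n D2).

Lemma state_catl t : t <= size D1 -> state n (D1 ++ D2) t = state n D1 t.
Proof. by move=> le_t; rewrite /state takel_cat. Qed.

Lemma state_catr t : state n (D1 ++ D2) (size D1 + t) = state n D2 t.
Proof.
rewrite /state take_cat ltnNge leq_addr /= addKn foldl_cat.
by have := state_end wf1; rewrite /state take_size => ->.
Qed.

Lemma wf_diagram_cat : wf_diagram n (D1 ++ D2).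
Proof.
apply/andP; split; last by rewrite size_cat state_catr state_end.
apply/allP => t; rewrite mem_iota size_cat /= add0n => lt_t; rewrite nth_cat.
case: ltnP => Ht; first by rewrite state_catl ?(ltnW Ht) // state_wf.
by rewrite -{1}(subnKC Ht) state_catr state_wf //; lia.
Qed.

Lemma step_catl t p : t < size D1 -> step n (D1 ++ D2) (t, p) = step n D1 (t, p).
Proof.
move=> lt_t; rewrite /step /dir /= state_catl ?(ltnW lt_t) // size_cat.
rewrite (ltn_addr _ lt_t) lt_t; case: ifP => _.
  rewrite nth_cat lt_t; case: nth => // k i.
  by rewrite /cross_step /outA /outB state_catl // ltnW.
case: t lt_t => // t lt_t; have lt_t1 := ltnW lt_t.
rewrite (ltn_addr _ lt_t1) lt_t1 nth_cat lt_t1; case: nth => // k i.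
by rewrite /cross_step /outA /outB state_catl // ltnW.
Qed.

Let shift (c : config) : config := (size D1 + c.1, c.2).

Lemma step_catr c : 
  step n (D1 ++ D2) (shift c) = [seq (x.1, shift x.2) | x <- step n D2 c].
Proof.
have nth2 t : nth (Cup 0) (D1 ++ D2) (size D1 + t) = nth (Cup 0) D2 t.
  by rewrite nth_cat ltnNge leq_addr /= addKn.
have cross2 k t i b : cross_step n (D1 ++ D2) k (size D1 + t) i b =
    [seq (x.1, shift x.2) | x <- cross_step n D2 k t i b].
  by rewrite /cross_step /outA /outB state_catr -addnS; case: k => [x|];
    split_ifs.
case: c => t p; rewrite /step /dir /= state_catr size_cat ltn_add2l nth2.
case: ifP => [_|Op].
  case: ifP => // _; case: nth => [k i|i o|i]; rewrite ?cross2 -?addnS;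
    by do ?case: ifP.
(* Going upwards from the top of [D2] would lead into [D1], but all points there are directed
   downwards. *)
case: t Op => [|t] Op; first by rewrite state0 nth_nseq_true in Op.
rewrite addnS ltn_add2l nth2; case: ifP => // _.
by case: nth => [k i|i o|i]; rewrite ?cross2 -?addnS; do ?case: ifP.
Qed.

Lemma terminating_cat :
  terminating n D1 -> terminating n D2 -> terminating n (D1 ++ D2).
Proof.
move=> term1 term2.
have lower m c : nexts n (D1 ++ D2) m (Some (shift c)) =
    omap shift (nexts n D2 m (Some c)).
  (* Every step in the lower part is the translate of a step in [D2], so whole trajectories
     translate. *)
  elim: m c => // m IH c; rewrite !nextsS /Defs.next step_catr.
  by case: step => [|[w d] r] /=; rewrite ?nexts_None ?IH.
have upper m c q : valid n D1 c -> nexts n D1 m (Some c) = Some (size D1, q) ->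
    nexts n (D1 ++ D2) m (Some c) = Some (size D1, q).
  elim: m c => // m IH c Hc; have [E|nbot] := eqVneq c.1 (size D1).
    by rewrite (surjective_pairing c) E nexts_bottom.
  have lt_c : c.1 < size D1 by rewrite ltn_neqAle nbot; case/andP: Hc.
  rewrite !nextsS; have -> : Defs.next n (D1 ++ D2) c = Defs.next n D1 c.
    by rewrite /Defs.next (surjective_pairing c) step_catl.
  case E: (Defs.next n D1 c) => [d|]; last by rewrite nexts_None.
  by apply: IH; apply: valid_next E.
have bottom t p : t <= size D2 -> p < size (state n D2 t) ->
    exists m q, nexts n (D1 ++ D2) m (Some (size D1 + t, p)) =
                Some (size (D1 ++ D2), q).
  move=> le_t lt_p; have [|m [q Hm]] := term2 (t, p); first exact/andP.
  by exists m, q; rewrite (lower m (t, p)) Hm size_cat.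
move=> [t p] /andP[/=]; rewrite size_cat => le_t lt_p.
case: (ltnP t (size D1)) => Ht; last first.
  rewrite -(subnKC Ht) -size_cat; apply: bottom; first by lia.
  by rewrite -state_catr subnKC.
have H1 : valid n D1 (t, p).
  by rewrite /valid /= (ltnW Ht) -state_catl // ltnW.
have [m [q Hm]] := term1 _ H1.
have /andP[/= _ Hq] := valid_nexts wf1 H1 Hm.
have [||m' [q' Hm']] := bottom 0 q; rewrite ?addn0 //.
  by rewrite state0 -(state_end wf1).
exists (m' + m), q'; rewrite nextsD (upper _ _ _ H1 Hm) -size_cat.
by rewrite addn0 in Hm'.
Qed.

End Stacking.

(** * Invariance, multiplicativity and the form of the entries *)

Lemma bbm_gen_move n D D' :
  is_diagram n D -> is_diagram n D' -> gen_move D D' -> bbm n D = bbm n D'.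
Proof.
move=> HD HD' Hmove; have [wfD _] := HD; have [wfD' _] := HD'.
apply/matrixP => i j.
(* For the unit vector at [j] as bottom values, the top value at [i] is the entry at [i], [j]; the
   same [a] serves both diagrams. *)
have [a [_ Ha]] := wrel_total wfD (terminating_diagram HD) (fun p => @delta_out n j p).
have Ha' := wrel_gen_move Hmove (owf_state wfD) Ha.
rewrite -[LHS](sum_delta (bbm n D i)) -[RHS](sum_delta (bbm n D' i)).
rewrite -(wrel_bbm wfD (terminating_diagram HD) i Ha).
by rewrite -(wrel_bbm wfD' (terminating_diagram HD') i Ha').
Qed.

Lemma bbm_cat n D1 D2 : is_diagram n D1 -> is_diagram n D2 ->
  bbm n (D1 ++ D2) = (bbm n D1 *m bbm n D2)%R.
Proof.
move=> H1 H2; have [wf1 _] := H1; have [wf2 _] := H2.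
have t1 := terminating_diagram H1; have t2 := terminating_diagram H2.
apply/matrixP => i j; rewrite [RHS]mxE.
(* [a2] is column [j] of [bbm n D2] extended by zero, and becomes the bottom values for [D1]. *)
have [a2 [a2_out Ha2]] := wrel_total wf2 t2 (fun p => @delta_out n j p).
have [a1 [_ Ha1]] := wrel_total wf1 t1 a2_out.
have Ha : wrel (Otop n) (D1 ++ D2) a1 (fun p => if p == j then 1%R else 0%R).
  apply/wrel_cat; exists a2 => //.
  have := oout_state wf1 (leqnn (size D1)).
  by rewrite take_size state_end // => ->.
have wfD := wf_diagram_cat wf1 wf2; have termD := terminating_cat wf1 wf2 t1 t2.
rewrite -(sum_delta (bbm n (D1 ++ D2) i) j) -(wrel_bbm wfD termD i Ha).
rewrite (wrel_bbm wf1 t1 i Ha1); apply: eq_bigr => k _.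
by rewrite (wrel_bbm wf2 t2 k Ha2) sum_delta.
Qed.

(** Modulo [s] the ball follows its strand, so the matrix reduces to that of the permutation of the
    endpoints. *)
Lemma dre_bbm n D (i j : 'I_n) : is_diagram n D ->
  dre (bbm n D i j) = 0%R \/ dre (bbm n D i j) = 1%R.
Proof.
move=> HD; have [wfD _] := HD; have termD := terminating_diagram HD.
have Hi : valid n D (0, val i) by rewrite /valid /= state0 size_nseq ltn_ord.
have [m [q Hm]] := termD _ Hi.
rewrite mxE (harmonic_dre wfD (psum_harmonic wfD termD j) Hi Hm) psum_bottom.
by case: eqP; [right|left].
Qed.

Lemma intr_dual (z : int) : (z%:~R = DN z 0 :> dual)%R.
Proof.
have natE (m : nat) : (m%:R = DN m%:Z 0 :> dual)%R.
  by elim: m => // m IH; rewrite -natr1 IH; apply: dual_eqP => //=; lia.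
case: z => m; rewrite ?NegzE ?mulrNz -pmulrn natE //.
Qed.

Theorem theorem2p1 (n : nat) :
  (* (1) every entry has the form a s + b with a in Z and b in {0,1} *)
  (forall D : seq layer, is_diagram n D ->
     forall i j : 'I_n, exists (a b : int),
       (b = 0%R \/ b = 1%R) /\ bbm n D i j = (a%:~R * eps + b%:~R)%R) /\
  (* (2) invariance under generalized Reidemeister moves and planar isotopy *)
  (forall D D' : seq layer, vsl_equiv n D D' -> bbm n D = bbm n D') /\
  (* multiplicativity under stacking (D1 on top of D2) *)
  (forall D1 D2 : seq layer, is_diagram n D1 -> is_diagram n D2 ->
     bbm n (D1 ++ D2) = (bbm n D1 *m bbm n D2)%R) /\
  (* the trivial n-string link is sent to the identity matrix *)
  bbm n [::] = 1%:M%R.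
Proof.
split=> [D HD i j|].
  exists (deps (bbm n D i j)), (dre (bbm n D i j)); split; first exact: dre_bbm.
  by rewrite !intr_dual; apply: dual_eqP => /=; lia.
split=> [D D'|].
  elim=> {D D'} [D D' [HD [HD' Hmove]]| // | D D' _ -> // | D D' D'' _ -> _ -> //].
  exact: bbm_gen_move.
split=> [D1 D2|]; first exact: bbm_cat.
apply/matrixP => i j; rewrite !mxE -val_eqE.
by rewrite /= mulrb.
Qed.
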